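(* Let $\mathbf{S}$ be a surreal substructure and $\Pi$ a convex partition of $\mathbf{S}$ such that the class $\mathbf{Smp}_\Pi$ of $\Pi$-simple elements is a surreal substructure. Then the following are equivalent: (a) $\Pi$ is sharp; (b) $\mathbf{Smp}_\Pi$ is $\mathbf{S}$-closed and $\pi_\Pi=\mu$; (c) $\pi_\Pi$ is $\sqsubseteq$-increasing (i.e. $x\sqsubseteq y$ implies $\pi_\Pi(x)\sqsubseteq\pi_\Pi(y)$ for $x,y\in\mathbf{S}$); (d) $\mathbf{Smp}_\Pi$ is $\mathbf{S}$-closed and $\mu$ is $\le$-increasing.
   Context: Surreal numbers are maps $x:\ell(x)\to\{-1,1\}$, $\ell(x)$ an ordinal; $\mathbf{No}$ is their class, ordered lexicographically (padding with $0$). Simplicity: $x\sqsubseteq y$ iff $y$ restricted to $\ell(x)$ equals $x$; $x\sqsubset y$ means $x\sqsubseteq y$, $x\ne y$. A surreal substructure is the image of a map $f:\mathbf{No}\to\mathbf{No}$ with $x\le y\iff f(x)\le f(y)$ and $x\sqsubseteq y\iff f(x)\sqsubseteq f(y)$; in a surreal substructure $\mathbf{S}$ every set totally ordered by $\sqsubseteq$ has a supremum in $(\mathbf{S},\sqsubseteq)$. A subclass $\mathbf{X}\subseteq\mathbf{S}$ is $\mathbf{S}$-closed if the supremum in $(\mathbf{S},\sqsubseteq)$ of every non-empty $\sqsubseteq$-chain in $\mathbf{X}$ lies in $\mathbf{X}$. A convex partition $\Pi$ of $\mathbf{S}$ is a partition into classes convex in $\mathbf{S}$; $\Pi[x]$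 is the member containing $x$; it has a $\sqsubseteq$-least element, and $\pi_\Pi(x)$ denotes it; $x$ is $\Pi$-simple if $x=\pi_\Pi(x)$. When $\mathbf{Smp}_\Pi$ is $\mathbf{S}$-closed, every $x\in\mathbf{S}$ has a $\sqsubseteq$-greatest element $\mu(x)$ among the $\Pi$-simple $y$ with $y\sqsubseteq x$. For $x\in\mathbf{S}$ let $x^{\mathbf{S}}_L=\{a\in\mathbf{S}:a\sqsubset x,a<x\}$, $x^{\mathbf{S}}_R=\{a\in\mathbf{S}:a\sqsubset x,a>x\}$. $\Pi$ is sharp if for every $\Pi$-simple $x$: for every $\Pi$-simple $y\in x^{\mathbf{S}}_L$ and every $z\in\Pi[y]$ there is $a\in x^{\mathbf{S}}_L$ with $z\le a$, and for every $\Pi$-simple $y\in x^{\mathbf{S}}_R$ and every $z\in\Pi[y]$ there is $a\in x^{\mathbf{S}}_R$ with $a\le z$. *)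

(* Defs.v *)
From HB Require Import structures.
From mathcomp Require Import all_boot order ssralg ssrnum ssrint.
From mathcomp Require Import boolp classical_sets.

Set Implicit Arguments.
Unset Strict Implicit.
Unset Printing Implicit Defensive.
Import Order.TTheory GRing.Theory Num.Theory.

Local Open Scope classical_set_scope.
Local Open Scope quotient_scope.

(* The types in [smallType] play the role of sets; [ord], [No] and their
   subsets live one universe higher and play the role of classes.  Proper
   classes are arbitrary predicates. *)
Definition smallType := Type.

(* [node f] stands for the least ordinal strictly above all the [f i].  Every
   ordinal is denoted by a tree, in general by several; [ord] identifies the
   trees denoting the same ordinal. *)
Inductive tree : Type := node (A : smallType) (f : A -> tree).

Fixpoint tle (s t : tree) {struct s} : Prop :=
  match s, t with node A f, node B g => forall i, exists j, tle (f i) (g j) end.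

Definition tlt (s t : tree) : Prop :=
  match t with node B g => exists j, tle s (g j) end.

Lemma tle_refl s : tle s s.
Proof. by elim: s => A f IH i; exists i; exact: IH. Qed.

Lemma tle_trans s t r : tle s t -> tle t r -> tle s r.
Proof.
elim: s t r => A f IH [B g] [C h] st tr i.
have [j fg] := st i; have [k gh] := tr j.
by exists k; exact: IH fg gh.
Qed.

HB.instance Definition _ := gen_eqMixin tree.
HB.instance Definition _ := gen_choiceMixin tree.

Definition teq (s t : tree) : bool := `[< tle s t /\ tle t s >].

Lemma teq_refl : reflexive teq.
Proof. by move=> s; apply/asboolP; split; exact: tle_refl. Qed.

Lemma teq_sym : symmetric teq.
Proof. by move=> s t; apply/asboolP/asboolP => -[]. Qed.

Lemma teq_trans : transitive teq.
Proof.
move=> s t r /asboolP[ts st] /asboolP[sr rs]; apply/asboolP; split.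
- exact: tle_trans ts sr.
- exact: tle_trans rs st.
Qed.

Canonical teq_equiv := EquivRel teq teq_refl teq_sym teq_trans.

Definition ord := {eq_quot teq_equiv}.

Definition olt (a b : ord) : Prop := tlt (repr a) (repr b).
Definition ole (a b : ord) : Prop := tle (repr a) (repr b).

(* [true] encodes the sign 1 and [false] the sign -1. *)
Record No := MkNo { len : ord ; sgn : {a : ord | olt a len} -> bool }.

HB.instance Definition _ := gen_eqMixin No.
HB.instance Definition _ := gen_choiceMixin No.

(* The sign sequence of [x] padded with 0. *)
Definition pad (x : No) (a : ord) : int :=
  match pselect (olt a (len x)) with
  | left h => if sgn (exist _ a h) then 1%R else (-1)%R
  | right _ => 0%R
  end.

Definition ltNo (x y : No) : Prop :=
  exists a, (forall b, olt b a -> pad x b = pad y b) /\ (pad x a < pad y a)%R.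

Definition leNo (x y : No) : Prop := x = y \/ ltNo x y.

Definition simpler (x y : No) : Prop :=
  ole (len x) (len y) /\ forall a, olt a (len x) -> pad y a = pad x a.

Definition ssimpler (x y : No) : Prop := simpler x y /\ x <> y.

Definition surreal_substructure (S : set No) : Prop :=
  exists f : No -> No,
    [/\ forall x y, leNo x y <-> leNo (f x) (f y),
        forall x y, simpler x y <-> simpler (f x) (f y)
      & S = range f].

Definition small (C : set No) : Prop :=
  exists (I : smallType) (F : I -> No), C = range F.

Definition simpler_ubound (C : set No) : set No :=
  [set u | forall x, C x -> simpler x u].

Definition is_sup_in (S C : set No) (s : No) : Prop :=
  [/\ S s, simpler_ubound C s
    & forall u, S u -> simpler_ubound C u -> simpler s u].

(* The chains are sets; in a surreal substructure [S] their suprema exist and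
   are unique, see [sup_in_exists] and [sup_in_unique]. *)
Definition closed_in (S X : set No) : Prop :=
  forall C : set No, small C -> C !=set0 -> C `<=` X -> total_on C simpler ->
  forall s, is_sup_in S C s -> X s.

Definition convex_in (S C : set No) : Prop :=
  C `<=` S /\
  forall a b c, C a -> C b -> S c -> leNo a c -> leNo c b -> C c.

Definition convex_partition (S : set No) (Pi : set (set No)) : Prop :=
  partition Pi id S /\ forall C, Pi C -> convex_in S C.

Definition block (Pi : set (set No)) (x : No) : set No := pblock Pi id x.

Definition is_least (C : set No) (m : No) : Prop :=
  C m /\ forall y, C y -> simpler m y.

Definition is_greatest (C : set No) (m : No) : Prop :=
  C m /\ forall y, C y -> simpler y m.

(* The default value is irrelevant on [S], see [pi_leastP]. *)
Definition pi_least (Pi : set (set No)) (x : No) : No :=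
  xget x (is_least (block Pi x)).

Definition Smp (S : set No) (Pi : set (set No)) : set No :=
  [set x | S x /\ x = pi_least Pi x].

(* The default value is irrelevant on [S] when [Smp S Pi] is closed in [S],
   see [muP]. *)
Definition mu (S : set No) (Pi : set (set No)) (x : No) : No :=
  xget x (is_greatest [set y | Smp S Pi y /\ simpler y x]).

Definition left_opts (S : set No) (x : No) : set No :=
  [set a | [/\ S a, ssimpler a x & ltNo a x]].

Definition right_opts (S : set No) (x : No) : set No :=
  [set a | [/\ S a, ssimpler a x & ltNo x a]].

Definition sharp (S : set No) (Pi : set (set No)) : Prop :=
  forall x, Smp S Pi x ->
    (forall y, Smp S Pi y -> left_opts S x y ->
       forall z, block Pi y z -> exists a, left_opts S x a /\ leNo z a) /\
    (forall y, Smp S Pi y -> right_opts S x y ->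
       forall z, block Pi y z -> exists a, right_opts S x a /\ leNo a z).

Lemma tle_node A (f : A -> tree) t : tle (node f) t <-> forall i, tlt (f i) t.
Proof. by case: t. Qed.

Lemma tle_lt_trans s t r : tle s t -> tlt t r -> tlt s r.
Proof. by case: r => C h st [k th]; exists k; exact: tle_trans th. Qed.

Lemma tlt_le_trans s t r : tlt s t -> tle t r -> tlt s r.
Proof. by case: t => B g [j sg] /tle_node/(_ j); exact: tle_lt_trans. Qed.

Lemma tlt_irr s : ~ tlt s s.
Proof. by elim: s => A f IH [i /tle_node/(_ i)]; exact: IH. Qed.

Lemma tle_or_lt s t : tle s t \/ tlt t s.
Proof.
elim: s t => A f IH [B g].
have [?|] := pselect (tle (node f) (node g)); [by left | move=> /existsNP[i fg]].
right; exists i; apply/tle_node => j; case: (IH i (g j)) => // fig.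
by case: fg; exists j.
Qed.

Lemma tltW s t : tlt s t -> tle s t.
Proof.
elim: t s => B g IH [A f] [j /tle_node sg]; apply/tle_node => i.
by exists j; exact: IH (sg i).
Qed.

Lemma tlt_wf : well_founded tlt.
Proof.
suff acc t : forall s, tle s t -> Acc tlt s by move=> t; apply: acc (tle_refl t).
elim: t => B g IH s sg; constructor => r rs.
by have [j rg] := tlt_le_trans rs sg; exact: IH rg.
Qed.

Lemma ole_refl a : ole a a. Proof. exact: tle_refl. Qed.
Lemma ole_trans a b c : ole a b -> ole b c -> ole a c.
Proof. exact: tle_trans. Qed.
Lemma olt_irr a : ~ olt a a. Proof. exact: tlt_irr. Qed.
Lemma oltW a b : olt a b -> ole a b. Proof. exact: tltW. Qed.
Lemma ole_lt_trans a b c : ole a b -> olt b c -> olt a c.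
Proof. exact: tle_lt_trans. Qed.
Lemma olt_le_trans a b c : olt a b -> ole b c -> olt a c.
Proof. exact: tlt_le_trans. Qed.
Lemma olt_trans a b c : olt a b -> olt b c -> olt a c.
Proof. by move=> /oltW; exact: ole_lt_trans. Qed.
Lemma ole_or_lt a b : ole a b \/ olt b a. Proof. exact: tle_or_lt. Qed.
Lemma oleNlt a b : ole a b <-> ~ olt b a.
Proof.
split=> [ab ba|]; first exact: (@olt_irr a (ole_lt_trans ab ba)).
by case: (ole_or_lt a b).
Qed.

Lemma ole_anti a b : ole a b -> ole b a -> a = b.
Proof.
by move=> ab ba; rewrite -[a]reprK -[b]reprK; apply/eqmodP/asboolP; split.
Qed.

Lemma olt_total a b : [\/ olt a b, a = b | olt b a].
Proof.
case: (ole_or_lt a b) => [ab|]; last by constructor 3.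
case: (ole_or_lt b a) => [ba|]; last by constructor 1.
by constructor 2; exact: ole_anti.
Qed.

Lemma olt_wf : well_founded olt.
Proof.
move=> a; have [t at_] : exists t, repr a = t by exists (repr a).
elim/(well_founded_ind tlt_wf): t a at_ => t IH a at_; constructor => b.
by rewrite /olt at_ => bt; exact: IH bt b erefl.
Qed.

Lemma ord_min (P : set ord) : P !=set0 ->
  exists a, P a /\ forall b, P b -> ole a b.
Proof.
move=> [a]; elim/(well_founded_ind olt_wf): a => a IH Pa.
have [[b [ba Pb]]|nb] := pselect (exists b, olt b a /\ P b); first exact: IH Pb.
by exists a; split=> // b Pb; apply/oleNlt => ba; apply: nb; exists b.
Qed.

Lemma tpi_repr t : tle (repr (\pi_ord t)) t /\ tle t (repr (\pi_ord t)).
Proof.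
have /eqmodP/asboolP // : repr (\pi_ord t) = t %[mod ord] by rewrite reprK.
Qed.

Lemma olt_pi a t : olt a (\pi_ord t) <-> tlt (repr a) t.
Proof.
have [h1 h2] := tpi_repr t.
by split=> h; [exact: tlt_le_trans h1 | exact: tlt_le_trans h2].
Qed.

Lemma ord_sup (I : smallType) (F : I -> ord) : exists b, forall i, olt (F i) b.
Proof.
exists (\pi_ord (node (fun i => repr (F i)))) => i; apply/olt_pi.
by exists i; exact: tle_refl.
Qed.

Lemma ord_succ a : exists b, olt a b.
Proof. by have [b ab] := ord_sup (fun _ : unit => a); exists b; exact: ab tt. Qed.

Lemma ord_init_small a :
  exists (I : smallType) (F : I -> ord), forall b, olt b a <-> exists i, b = F i.
Proof.
rewrite -[a]reprK; elim: (repr a) => {a} A f IH.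
pose J i := projT1 (cid (IH i)).
have HJ i : exists F : J i -> ord,
    forall b, olt b (\pi_ord (f i)) <-> exists j, b = F j.
  exact: projT2 (cid (IH i)).
pose G i := projT1 (cid (HJ i)).
have HG i b : olt b (\pi_ord (f i)) <-> exists j, b = G i j.
  exact: (projT2 (cid (HJ i)) b).
exists {i : A & option (J i)}.
exists (fun p => if projT2 p is Some j then G _ j else \pi_ord (f (projT1 p))) => b.
split=> [/olt_pi[i bi]|[[i [j|]] /= ->]].
- have bi' : ole b (\pi_ord (f i)) by apply: tle_trans bi _; have [] := tpi_repr (f i).
  have [/HG[j ->]|->|ib] := olt_total b (\pi_ord (f i)).
  + by exists (existT _ i (Some j)).
  + by exists (existT _ i None).
  + by move/oleNlt: bi' => /(_ ib).
- apply/olt_pi; exists i; apply: tltW.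
  by apply/olt_pi/HG; exists j.
- by apply/olt_pi; exists i; have [] := tpi_repr (f i).
Qed.

Lemma order_type (A : smallType) (R : A -> A -> Prop) :
  well_founded R -> (forall x y z, R x y -> R y z -> R x z) ->
  (forall x y, [\/ R x y, x = y | R y x]) ->
  exists (a : ord) (h : A -> ord),
    (forall x y, R x y <-> olt (h x) (h y)) /\
    (forall b, olt b a <-> exists x, b = h x).
Proof.
move=> wfR trR totR.
pose T := Fix wfR (fun _ => tree)
  (fun x rec => @node {y | R y x} (fun y => rec (sval y) (svalP y))).
have TE x : T x = node (fun y : {y | R y x} => T (sval y)).
  rewrite /T Fix_eq // => z f g fg; congr (@node _ _).
  by apply: functional_extensionality_dep => -[].
pose h x : ord := \pi_ord (T x).
have hR x y : R x y -> olt (h x) (h y).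
  move=> xy; apply/olt_pi; rewrite TE; exists (exist _ x xy) => /=.
  by have [] := tpi_repr (T x).
have hRE x y : R x y <-> olt (h x) (h y).
  split=> [|hxy]; first exact: hR.
  have [//|xy|/hR yx] := totR x y.
    by rewrite xy in hxy; case: (olt_irr hxy).
  by case: (@olt_irr (h x)); exact: olt_trans yx.
have below b x : ole b (h x) -> exists y, b = h y.
  elim/(well_founded_ind wfR): x => x IH bx.
  have [|->|xb] := olt_total b (h x); last 2 first.
  - by exists x.
  - by move/oleNlt: bx => /(_ xb).
  move=> /olt_pi; rewrite TE => -[[y yx] /= by_]; apply: (IH y yx).
  by apply: tle_trans by_ _; have [] := tpi_repr (T y).
exists (\pi_ord (node T)), h; split=> // b; split=> [/olt_pi[x bx]|[x ->]].
- by apply: (below b x); apply: tle_trans bx _; have [] := tpi_repr (T x).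
- by apply/olt_pi; exists x; have [] := tpi_repr (T x).
Qed.

Lemma pad_eq0 x a : pad x a = 0%R <-> ole (len x) a.
Proof.
rewrite /pad; case: pselect => [h|h]; split => //.
- by case: ifP.
- by move=> /oleNlt.
- by move=> _; apply/oleNlt.
Qed.

Lemma pad_val x a : olt a (len x) -> pad x a = 1%R \/ pad x a = (-1)%R.
Proof. by rewrite /pad; case: pselect => // h _; case: ifP; [left|right]. Qed.

Definition mkNo (a : ord) (g : ord -> bool) : No :=
  @MkNo a (fun b => g (sval b)).

Lemma pad_mkNo a g b : olt b a ->
  pad (mkNo a g) b = if g b then 1%R else (-1)%R.
Proof. by rewrite /pad /=; case: pselect. Qed.

Lemma No_ext x y : (forall a, pad x a = pad y a) -> x = y.
Proof.
move=> xy.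
have lenE : len x = len y.
  apply: ole_anti; apply/pad_eq0; first by rewrite xy; apply/pad_eq0/ole_refl.
  by rewrite -xy; apply/pad_eq0/ole_refl.
case: x y lenE xy => [a f] [b g] /= ab; subst b => xy; congr MkNo.
apply: functional_extensionality_dep => -[c ca]; have := xy c; rewrite /pad /=.
case: pselect => // ca'; rewrite (Prop_irrelevance ca' ca).
by case: (f _); case: (g _).
Qed.

Lemma simpler_refl x : simpler x x.
Proof. by split=> //; exact: ole_refl. Qed.

Lemma simpler_trans y x z : simpler x y -> simpler y z -> simpler x z.
Proof.
move=> [xy pxy] [yz pyz]; split; first exact: ole_trans yz.
by move=> a ax; rewrite pyz ?pxy//; exact: olt_le_trans xy.
Qed.

Lemma simpler_anti x y : simpler x y -> simpler y x -> x = y.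
Proof.
move=> [xy pxy] [yx pyx]; apply: No_ext => a.
have [xa|ax] := ole_or_lt (len x) a; last by rewrite pxy.
by rewrite (pad_eq0 x a).2// (pad_eq0 y a).2//; exact: ole_trans xa.
Qed.

Lemma pad_diff x y : x <> y ->
  exists a, (forall b, olt b a -> pad x b = pad y b) /\ pad x a <> pad y a.
Proof.
move=> xy.
have [|a [xya amin]] := @ord_min [set a | pad x a <> pad y a].
  by apply: contrapT => h; apply: xy; apply: No_ext => a;
    apply: contrapT => na; apply: h; exists a.
exists a; split=> // b ba; apply: contrapT => /amin/oleNlt.
exact.
Qed.

Lemma ltNo_irr x : ~ ltNo x x.
Proof. by move=> [a [_]]; rewrite ltxx. Qed.

Lemma ltNo_trans y x z : ltNo x y -> ltNo y z -> ltNo x z.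
Proof.
move=> [a [xy ltxy]] [b [yz ltyz]].
have [ab|E|ba] := olt_total a b.
- exists a; split=> [c ca|]; last by rewrite -yz.
  by rewrite xy// yz//; exact: olt_trans ab.
- subst b; exists a; split=> [c ca|]; first by rewrite xy// yz.
  exact: lt_trans ltyz.
- exists b; split=> [c cb|]; last by rewrite xy.
  by rewrite xy ?yz//; exact: olt_trans ba.
Qed.

Lemma ltNo_total x y : [\/ ltNo x y, x = y | ltNo y x].
Proof.
have [->|/pad_diff[a [xy nxy]]] := pselect (x = y); first by constructor 2.
have [lt|lt|//] := ltgtP (pad x a) (pad y a).
- by constructor 1; exists a.
- by constructor 3; exists a; split=> // b ba; rewrite xy.
Qed.

Lemma simpler_total z x y : simpler x z -> simpler y z ->
  simpler x y \/ simpler y x.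
Proof.
move=> [xz pxz] [yz pyz].
have [xy|/oltW yx] := ole_or_lt (len x) (len y); [left|right]; split=> // a ha.
- by rewrite -pxz -?pyz//; exact: olt_le_trans xy.
- by rewrite -pyz -?pxz//; exact: olt_le_trans yx.
Qed.

Lemma sup_in_unique S C s t : is_sup_in S C s -> is_sup_in S C t -> s = t.
Proof.
by move=> [Ss us ms] [St ut mt]; apply: simpler_anti; [exact: ms|exact: mt].
Qed.

Lemma sup_No_exists C : small C -> total_on C simpler ->
  exists s, is_sup_in setT C s.
Proof.
move=> [I [F CE]] Ctot.
have [|L [Lub Lmin]] := @ord_min [set a | forall x, C x -> ole (len x) a].
  have [b hb] := ord_sup (fun i => len (F i)).
  by exists b => x; rewrite CE => -[i _ <-]; exact: oltW.
pose g a := `[< exists x, C x /\ pad x a = 1%R >].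
have gE x a : C x -> olt a (len x) -> pad (mkNo L g) a = pad x a.
  move=> Cx ax; rewrite pad_mkNo; last by apply: olt_le_trans ax _; exact: Lub.
  have [xa|xa] := pad_val ax; rewrite xa.
    by rewrite (_ : g a = true)//; apply/asboolP; exists x.
  rewrite (_ : g a = false)//; apply/asboolPn => -[y [Cy ya]].
  have [[_ /(_ a ax)]|[_ h]] := Ctot x y Cx Cy; first by rewrite xa ya.
  have [/pad_eq0|/h] := ole_or_lt (len y) a; first by rewrite ya.
  by rewrite xa ya.
exists (mkNo L g); split=> // [x Cx|u _ uub].
  by split=> [|a ax]; [exact: Lub|exact: gE].
split=> [|a /= aL]; first by apply: Lmin => x /uub[].
have [x [Cx ax]] : exists x, C x /\ olt a (len x).
  apply: contrapT => h.
  suff /Lmin/oleNlt : forall x, C x -> ole (len x) a by [].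
  by move=> x Cx; apply/oleNlt => ax; apply: h; exists x.
by rewrite (gE x)//; have [_ ->] := uub x Cx.
Qed.

Lemma sup_in_exists S C : surreal_substructure S -> small C -> C `<=` S ->
  total_on C simpler -> exists s, is_sup_in S C s.
Proof.
move=> [f [_ fs SE]] [I [F CE]] CS Ctot.
have pre i : exists x, f x = F i.
  have : S (F i) by apply: CS; rewrite CE; exists i.
  by rewrite SE => -[x _ <-]; exists x.
pose G i := projT1 (cid (pre i)).
have GE i : f (G i) = F i by exact: projT2 (cid (pre i)).
have [||s [_ sub smin]] := @sup_No_exists (range G).
- by exists I, G.
- move=> _ _ [i _ <-] [j _ <-].
  have CF k : C (F k) by rewrite CE; exists k.
  have [h|h] := Ctot _ _ (CF i) (CF j); [left|right]; apply/fs; by rewrite !GE.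
exists (f s); split=> [|x|u]; first by rewrite SE; exists s.
- by rewrite CE => -[i _ <-]; rewrite -GE; apply: (fs _ _).1; apply: sub; exists i.
- rewrite SE => -[v _ <-] uub; apply: (fs _ _).1; apply: smin => // _ [i _ <-].
  by apply/fs; rewrite GE; apply: uub; rewrite CE; exists i.
Qed.

Lemma convex_least S C : surreal_substructure S -> convex_in S C -> C !=set0 ->
  exists m, is_least C m.
Proof.
move=> [f [fl fs SE]] [CS Cconv] [c Cc].
have [|l [[x Cx xl] lmin]] := @ord_min [set len x | x in f @^-1` C].
  have := CS _ Cc; rewrite SE => -[x _ fx].
  by exists (len x), x => //=; rewrite fx.
have btw y z t : C (f y) -> C (f z) -> ltNo y t -> ltNo t z -> C (f t).
  move=> Cy Cz yt tz; apply: (Cconv (f y) (f z)) => //.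
  - by rewrite SE; exists t.
  - by apply: (fl _ _).1; right.
  - by apply: (fl _ _).1; right.
exists (f x); split=> // fy Cfy; have := CS _ Cfy; rewrite SE => -[y _ fyE].
subst fy l; apply: (fs _ _).1.
have xy : ole (len x) (len y) by apply: lmin; exists y.
split=> // a ax; apply: contrapT => nxy.
have [xEy|{}/pad_diff[b [beq bne]]] := pselect (x = y); first by rewrite xEy in nxy.
have bx : olt b (len x).
  have [xb|//] := ole_or_lt (len x) b.
  by case: nxy; rewrite beq//; exact: olt_le_trans xb.
pose z := mkNo b (fun c => pad x c == 1%R).
have zx d : olt d b -> pad z d = pad x d.
  move=> cb; rewrite pad_mkNo//.
  by have [->|->] := pad_val (olt_trans cb bx).
have zb : pad z b = 0%R by apply/pad_eq0; exact: ole_refl.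
suff Cz : C (f z) by have /oleNlt := lmin b (ex_intro2 _ _ z Cz erefl); apply.
have [xb|xb] := pad_val bx; have [yb|yb] := pad_val (olt_le_trans bx xy).
- by rewrite xb yb in bne.
- apply: (btw y x) => //; exists b; (split; last by rewrite ?zb ?xb ?yb) => d db.
  + by rewrite zx// beq.
  + by rewrite zx.
- apply: (btw x y) => //; exists b; (split; last by rewrite ?zb ?xb ?yb) => d db.
  + by rewrite zx.
  + by rewrite zx// beq.
- by rewrite xb yb in bne.
Qed.

Lemma blockP S Pi x : convex_partition S Pi -> S x ->
  Pi (block Pi x) /\ block Pi x x.
Proof.
move=> [[PiS _ _] _]; rewrite -PiS => -[C PiC Cx].
exact: (@getPex _ [set C | Pi C /\ C x] (ex_intro _ C (conj PiC Cx))).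
Qed.

Lemma block_unique S Pi C x : convex_partition S Pi -> Pi C -> C x ->
  block Pi x = C.
Proof.
move=> hPi PiC Cx; have Sx : S x by have [_ /(_ C PiC)[CS _]] := hPi; exact: CS.
have [PiB Bx] := blockP hPi Sx; have [[_ tr _] _] := hPi.
by apply: tr => //; exists x.
Qed.

Lemma pi_leastP S Pi x : surreal_substructure S -> convex_partition S Pi ->
  S x -> is_least (block Pi x) (pi_least Pi x).
Proof.
move=> hS hPi Sx; have [PiB Bx] := blockP hPi Sx.
have hB : convex_in S (block Pi x) by have [_] := hPi; apply.
by apply: xgetPex; apply: (convex_least hS hB); exists x.
Qed.

Lemma muP S Pi x : surreal_substructure S -> convex_partition S Pi ->
  closed_in S (Smp S Pi) -> S x ->
  is_greatest [set y | Smp S Pi y /\ simpler y x] (mu S Pi x).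
Proof.
move=> hS hPi hcl Sx; apply: xgetPex; set C := [set y | _].
have C0 : C !=set0.
  have [r [Sr rmin]] : exists r, S r /\ forall y, S y -> simpler r y.
    have SS : convex_in S S by split.
    by have [|r rmin] := convex_least hS SS; [exists x|exists r].
  exists r; split; last exact: rmin.
  split=> //; have [PiB Br] := blockP hPi Sr.
  have [Bp pmin] := pi_leastP hS hPi Sr.
  have [_ /(_ _ PiB)[BS _]] := hPi.
  by apply: simpler_anti; [exact: rmin (BS _ Bp)|exact: pmin].
have [b xb] := ord_succ (len x); have [I [F FE]] := ord_init_small b.
pose G a := mkNo a (fun c => pad x c == 1%R).
have Csmall : small C.
  exists {i | C (G (F i))}, (fun i => G (F (sval i))).
  apply/seteqP; split=> [y Cy|_ [[i Ci] _ <-]] //.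
  have [_ [lyx pyx]] := Cy.
  have /FE[i yi] : olt (len y) b by exact: ole_lt_trans xb.
  have yE : G (F i) = y.
    apply: No_ext => a; rewrite -yi.
    have [ya|ay] := ole_or_lt (len y) a.
      by rewrite (pad_eq0 y a).2//; apply/pad_eq0.
    by rewrite pad_mkNo// pyx//; have [->|->] := pad_val ay.
  have Ci : C (G (F i)) by rewrite yE.
  by exists (exist _ i Ci).
have CSmp : C `<=` Smp S Pi by move=> y [].
have Ctot : total_on C simpler.
  by move=> y z [_ yx] [_ zx]; exact: simpler_total zx.
have CS : C `<=` S by move=> y /CSmp[].
have [s hs] := sup_in_exists hS Csmall CS Ctot.
exists s; split; last by move=> y Cy; have [_ + _] := hs; apply.
split; first exact: hcl hs.
by have [_ _] := hs; apply=> // y [].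
Qed.

(* Main.v *)
(** All four conditions amount to [pi_least] being [simpler]-monotone.

    Sharpness gives monotonicity: if [v = pi_least Pi y] is strictly simpler
    than a simple [u] which is simpler than [y], with [v < u] say, then some
    [a < u] strictly simpler than [u] has [y <= a]; but the sign of [u] at [a]
    is also that of [y], so [a < y].  Conversely, for a simple [x], a simple
    left option [y] of [x] and [z] in the block of [y], the longest common
    initial segment of [z] and [x] in [S] lies between them, and it is not [x]
    because [pi_least] is monotone.

    If [mu] is [<=]-increasing but [u = pi_least Pi x] differs from
    [v = mu S Pi x], say [u < v], then density of the simple elements yields a
    simple [w] with [u < w < v]; since [u < w] and [w] is not in the block of
    [x], we get [x < w], whence [v = mu x <= mu w = w], which is absurd. *)
Require Import Defs.
From mathcomp Require Import all_boot classical_sets.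
From mathcomp Require Import order ssralg ssrnum ssrint boolp.

Set Implicit Arguments.
Unset Strict Implicit.
Unset Printing Implicit Defensive.
Import Order.TTheory GRing.Theory Num.Theory.

Local Open Scope classical_set_scope.

(** * Order, simplicity and density in [No] *)

Lemma ltNo_nle x y : ltNo x y <-> ~ leNo y x.
Proof.
split=> [xy [E|yx]|nyx].
- by rewrite E in xy; exact: ltNo_irr xy.
- exact: ltNo_irr (ltNo_trans xy yx).
- have [//|E|yx] := ltNo_total x y.
    by case: nyx; left.
  by case: nyx; right.
Qed.

(** The first difference between [x] and [u] lies at or past the end of [x] but before the end of
    [u], where [y] still agrees with [u]. *)
Lemma simpler_lt_ext u x y :
  simpler x u -> simpler u y -> ltNo x u -> ltNo x y.
Proof.
move=> [_ pxu] [_ puy] [a [eqa lta]].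
have [xa|/pxu E] := ole_or_lt (len x) a; last by rewrite E ltxx in lta.
have [/pad_eq0 ua|au] := ole_or_lt (len u) a.
  by rewrite ua (pad_eq0 x a).2// ltxx in lta.
exists a; split=> [b ba|]; last by rewrite puy.
by rewrite eqa// puy//; exact: olt_trans au.
Qed.

Lemma simpler_gt_ext u x y :
  simpler x u -> simpler u y -> ltNo u x -> ltNo y x.
Proof.
move=> [_ pxu] [_ puy] [a [eqa lta]].
have [xa|/pxu E] := ole_or_lt (len x) a; last by rewrite E ltxx in lta.
have [/pad_eq0 ua|au] := ole_or_lt (len u) a.
  by rewrite ua (pad_eq0 x a).2// ltxx in lta.
exists a; split=> [b ba|]; last by rewrite puy.
by rewrite -eqa// puy//; exact: olt_trans au.
Qed.

Lemma No_dense x y : ltNo x y -> exists z, ltNo x z /\ ltNo z y.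
Proof.
move=> [a [eqa lta]].
have [ya|ay] := ole_or_lt (len y) a.
- have ya0 : pad y a = 0%R by apply/pad_eq0.
  have ax : olt a (len x).
    have [/pad_eq0 xa|//] := ole_or_lt (len x) a.
    by rewrite xa ya0 ltxx in lta.
  have [b xb] := ord_succ (len x).
  (* [x] continued by signs 1, as the padding 0 passes the test. It stays below [y] because [x]
     already is at [a]. The other case continues [y] by signs -1. *)
  pose z := mkNo b (fun c => pad x c != (-1)%R).
  have zx c : olt c (len x) -> pad z c = pad x c.
    move=> cx; rewrite pad_mkNo; last exact: olt_trans xb.
    by have [->|->] := pad_val cx.
  exists z; split.
  + exists (len x); split=> [c cx|]; first by rewrite zx.
    by rewrite pad_mkNo// (pad_eq0 x (len x)).2//; exact: ole_refl.
  + exists a; split=> [c ca|]; last by rewrite zx.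
    by rewrite zx ?eqa//; exact: olt_trans ax.
- have [b yb] := ord_succ (len y).
  pose z := mkNo b (fun c => pad y c == 1%R).
  have zy c : olt c (len y) -> pad z c = pad y c.
    move=> cy; rewrite pad_mkNo; last exact: olt_trans yb.
    by have [->|->] := pad_val cy.
  exists z; split.
  + exists a; split=> [c ca|]; last by rewrite zy.
    by rewrite zy ?eqa//; exact: olt_trans ay.
  + exists (len y); split=> [c cy|]; first by rewrite zy.
    by rewrite pad_mkNo// (pad_eq0 y (len y)).2//; exact: ole_refl.
Qed.

(** Cut both numbers at their first difference [d]. If one of them ends there, it is the witness;
    otherwise the common part has padding 0 at [d], between the signs -1 of [z] and 1 of [x]. *)
Lemma No_meet_between z x : ltNo z x ->
  exists a, [/\ simpler a z, simpler a x, leNo z a & leNo a x].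
Proof.
move=> zx; have [d [eqd ltd]] := zx.
have [zd|dz] := ole_or_lt (len z) d.
  have dx : olt d (len x).
    have [/pad_eq0 xd|//] := ole_or_lt (len x) d.
    by rewrite xd (pad_eq0 z d).2// ltxx in ltd.
  exists z; split; [exact: simpler_refl| |by left|by right].
  split=> [|c cz]; first by apply: oltW; exact: ole_lt_trans dx.
  by rewrite eqd//; exact: olt_le_trans zd.
have [xd|dx] := ole_or_lt (len x) d.
  exists x; split; [|exact: simpler_refl|by right|by left].
  split=> [|c cx]; first by apply: oltW; exact: ole_lt_trans dz.
  by rewrite eqd//; exact: olt_le_trans xd.
pose a := mkNo d (fun c => pad x c == 1%R).
have ax c : olt c d -> pad a c = pad x c.
  move=> cd; rewrite pad_mkNo//.
  by have [->|->] := pad_val (olt_trans cd dx).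
have ad : pad a d = 0%R by apply/pad_eq0; exact: ole_refl.
have [zdE xdE] : pad z d = (-1)%R /\ pad x d = 1%R.
  by move: ltd; have [->|->] := pad_val dz; have [->|->] := pad_val dx.
exists a; split.
- by split=> [|c cd]; [exact: oltW|rewrite ax// eqd].
- by split=> [|c cd]; [exact: oltW|rewrite ax].
- by right; exists d; split=> [c cd|]; [rewrite ax// eqd|rewrite ad zdE].
- by right; exists d; split=> [c cd|]; [rewrite ax|rewrite ad xdE].
Qed.

(** * Transfer to surreal substructures *)

Lemma leNo_embedding_lt (f : No -> No) :
  (forall x y, leNo x y <-> leNo (f x) (f y)) ->
  forall x y, ltNo x y <-> ltNo (f x) (f y).
Proof.
move=> fl x y; split=> /ltNo_nle h; apply/ltNo_nle; apply: contra_not h.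
- exact: (fl y x).2.
- exact: (fl y x).1.
Qed.

Lemma substructure_dense S x y : surreal_substructure S -> S x -> S y ->
  ltNo x y -> exists z, [/\ S z, ltNo x z & ltNo z y].
Proof.
move=> [f [/leNo_embedding_lt fl _ ->]] [x' _ <-] [y' _ <-].
move=> /(fl x' y').2/No_dense[z [xz zy]].
by exists (f z); split; [exists z|exact: (fl _ _).1|exact: (fl _ _).1].
Qed.

Lemma substructure_meet_between S z x : surreal_substructure S -> S z -> S x ->
  ltNo z x -> exists a, [/\ S a, simpler a z, simpler a x, leNo z a & leNo a x].
Proof.
move=> [f [fl fs ->]] [z' _ <-] [x' _ <-] /(leNo_embedding_lt fl z' x').2.
move=> /No_meet_between[a [/fs az /fs ax /fl za /fl xa]].
by exists (f a); split=> //; exists a.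
Qed.

(** * The projection onto simple elements *)

Section ConvexPartition.
Variables (S : set No) (Pi : set (set No)).
Hypotheses (hS : surreal_substructure S) (hPi : convex_partition S Pi).

Lemma block_sub x : S x -> block Pi x `<=` S.
Proof.
by move=> /(blockP hPi)[PiB _]; have [_ /(_ _ PiB)[]] := hPi.
Qed.

Lemma block_pi_least x : S x -> block Pi x (pi_least Pi x).
Proof. by move=> /(pi_leastP hS hPi)[]. Qed.

Lemma pi_least_simpler x : S x -> simpler (pi_least Pi x) x.
Proof.
by move=> Sx; have [_] := pi_leastP hS hPi Sx; apply; have [] := blockP hPi Sx.
Qed.

Lemma pi_least_block x y : S x -> block Pi x y -> pi_least Pi y = pi_least Pi x.
Proof.
move=> Sx xy; have [PiB _] := blockP hPi Sx.
have [Bx mx] := pi_leastP hS hPi Sx.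
have := pi_leastP hS hPi (block_sub Sx xy).
rewrite (block_unique hPi PiB xy) => -[By my].
by apply: simpler_anti; [exact: my|exact: mx].
Qed.

Lemma Smp_pi_least x : S x -> Smp S Pi (pi_least Pi x).
Proof.
move=> Sx; have B := block_pi_least Sx.
by split; [exact: (block_sub Sx)|rewrite (pi_least_block Sx B)].
Qed.

(** If the projections were reversed, convexity would put [pi_least Pi y] in the block of [x], or
    [x] in the block of [y], so the projections would coincide. *)
Lemma pi_least_le x y : S x -> S y -> leNo x y ->
  leNo (pi_least Pi x) (pi_least Pi y).
Proof.
move=> Sx Sy xy; apply: contrapT => /ltNo_nle pyx.
have conv z : S z -> convex_in S (block Pi z).
  by move=> /(blockP hPi)[PiB _]; have [_] := hPi; apply.
have [[Spx _] [Spy _]] := (Smp_pi_least Sx, Smp_pi_least Sy).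
suff E : pi_least Pi x = pi_least Pi y by rewrite E in pyx; exact: ltNo_irr pyx.
have [xpy|/ltNo_nle pyx'] := pselect (leNo x (pi_least Pi y)).
  have [_ /(_ x (pi_least Pi x) (pi_least Pi y)) h] := conv x Sx.
  rewrite -(@pi_least_block x (pi_least Pi y))//.
    by rewrite (pi_least_block Sy (block_pi_least Sy)).
  apply: h => //; [by have [] := blockP hPi Sx|exact: block_pi_least|by right].
have [_ /(_ (pi_least Pi y) y x) h] := conv y Sy.
apply: pi_least_block => //.
by apply: h => //; [exact: block_pi_least|have [] := blockP hPi Sy|right].
Qed.

Lemma lt_Smp x w : S x -> Smp S Pi w -> ltNo (pi_least Pi x) w -> ltNo x w.
Proof.
move=> Sx [Sw wE] xw; apply/ltNo_nle => /(pi_least_le Sw Sx).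
by rewrite -wE; exact/ltNo_nle.
Qed.

Lemma Smp_lt x w : S x -> Smp S Pi w -> ltNo w (pi_least Pi x) -> ltNo w x.
Proof.
move=> Sx [Sw wE] xw; apply/ltNo_nle => /(pi_least_le Sx Sw).
by rewrite -wE; exact/ltNo_nle.
Qed.

(** * Equivalences with monotonicity of the projection *)

Definition pi_least_monotone := forall x y, S x -> S y -> simpler x y ->
  simpler (pi_least Pi x) (pi_least Pi y).

Lemma sharp_pi_least_monotone : sharp S Pi -> pi_least_monotone.
Proof.
move=> sh x y Sx Sy xy; have su := Smp_pi_least Sx; have sv := Smp_pi_least Sy.
have uy := simpler_trans (pi_least_simpler Sx) xy.
have vy := pi_least_simpler Sy.
(* From here on it only matters that [u] is simple and an initial segment of [y]. *)
move: (pi_least Pi x) su uy => u su uy.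
have [//|vu] := simpler_total uy vy; apply: contrapT => nuv.
have svu : ssimpler (pi_least Pi y) u.
  by split=> // E; apply: nuv; rewrite E; exact: simpler_refl.
have yB : block Pi (pi_least Pi y) y.
  have [PiB By] := blockP hPi Sy.
  by rewrite (block_unique hPi PiB (block_pi_least Sy)).
have [shl shr] := sh u su; have [Sv _] := sv.
have [lt|E|lt] := ltNo_total (pi_least Pi y) u.
- have [|a [[_ [au _] lau]]] := shl _ sv _ _ yB; first by split.
  exact/ltNo_nle/(simpler_lt_ext au uy).
- by case: svu.
- have [|a [[_ [au _] lau]]] := shr _ sv _ _ yB; first by split.
  exact/ltNo_nle/(simpler_gt_ext au uy).
Qed.

Lemma mu_Smp x : closed_in S (Smp S Pi) -> Smp S Pi x -> mu S Pi x = x.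
Proof.
move=> cl sx; have [Sx _] := sx; have [[_ mx] xm] := muP hS hPi cl Sx.
apply: simpler_anti => //; apply: xm.
by split=> //; exact: simpler_refl.
Qed.

(** Members of the chain are their own projections, so by monotonicity the projection of [s] is
    again an upper bound, and [s] is simpler than it. *)
Lemma pi_least_monotone_closed : pi_least_monotone -> closed_in S (Smp S Pi).
Proof.
move=> mono C _ _ CSmp _ s [Ss us ms]; split=> //.
have [Sp _] := Smp_pi_least Ss.
apply: simpler_anti; last exact: pi_least_simpler.
apply: ms => // x Cx; have [Sx ->] := CSmp x Cx.
by apply: mono => //; exact: us.
Qed.

Lemma pi_least_monotone_mu : pi_least_monotone ->
  forall x, S x -> pi_least Pi x = mu S Pi x.
Proof.
move=> mono x Sx.
have [[[Sm mE] mx] gm] := muP hS hPi (pi_least_monotone_closed mono) Sx.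
apply: simpler_anti; last by rewrite {1}mE; exact: mono.
by apply: gm; split; [exact: Smp_pi_least|exact: pi_least_simpler].
Qed.

(** Simple initial segments of [x] are also initial segments of [y], so [mu] grows with
    simplicity. *)
Lemma mu_pi_least_monotone : closed_in S (Smp S Pi) ->
  (forall x, S x -> pi_least Pi x = mu S Pi x) -> pi_least_monotone.
Proof.
move=> cl piE x y Sx Sy xy; rewrite !piE//.
have [[smx mx] _] := muP hS hPi cl Sx; have [_ gy] := muP hS hPi cl Sy.
by apply: gy; split=> //; exact: simpler_trans xy.
Qed.

Lemma mu_increasing_pi_least : surreal_substructure (Smp S Pi) ->
  closed_in S (Smp S Pi) ->
  (forall x y, S x -> S y -> leNo x y -> leNo (mu S Pi x) (mu S Pi y)) ->
  forall x, S x -> pi_least Pi x = mu S Pi x.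
Proof.
move=> hSmp cl inc x Sx; have su := Smp_pi_least Sx.
have [[sv _] _] := muP hS hPi cl Sx.
have [lt|//|lt] := ltNo_total (pi_least Pi x) (mu S Pi x).
(* Density is taken inside [Smp S Pi], so that [mu] fixes [w]. *)
- have [w [sw uw wv]] := substructure_dense hSmp su sv lt.
  have [Sw _] := sw.
  have := inc x w Sx Sw (or_intror (lt_Smp Sx sw uw)).
  by rewrite (mu_Smp cl sw) => /((ltNo_nle _ _).1 wv).
- have [w [sw vw wu]] := substructure_dense hSmp sv su lt.
  have [Sw _] := sw.
  have := inc w x Sw Sx (or_intror (Smp_lt Sx sw wu)).
  by rewrite (mu_Smp cl sw) => /((ltNo_nle _ _).1 vw).
Qed.

Lemma pi_least_monotone_sharp : pi_least_monotone -> sharp S Pi.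
Proof.
move=> mono x sx; have [Sx xE] := sx.
(* If [a] were [x], then [x] would be simpler than [z], hence by monotonicity simpler than the
   projection [y] of [z], although [y] is strictly simpler than [x]. *)
have key y z a : Smp S Pi y -> ssimpler y x -> block Pi y z ->
    S a -> simpler a z -> simpler a x -> ssimpler a x.
  move=> [Sy yE] [yx nyx] yz Sa az ax; split=> // E; subst a; apply: nyx.
  apply: simpler_anti => //; rewrite xE yE -(pi_least_block Sy yz).
  by apply: mono => //; exact: (block_sub Sy).
split=> y sy [Sy ysx yx] z yz; have Sz := block_sub Sy yz.
- have zx : ltNo z x.
    by apply: lt_Smp => //; rewrite (pi_least_block Sy yz); have [_ <-] := sy.
  have [a [Sa az ax za [E|]]] := substructure_meet_between hS Sz Sx zx.
    by have [] := key _ _ _ sy ysx yz Sa az ax.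
  by exists a; split=> //; split=> //; exact: (key y z).
- have xz : ltNo x z.
    by apply: Smp_lt => //; rewrite (pi_least_block Sy yz); have [_ <-] := sy.
  have [a [Sa ax az [E|] za]] := substructure_meet_between hS Sx Sz xz.
    by have [_] := key _ _ _ sy ysx yz Sa az ax; rewrite E.
  by exists a; split=> //; split=> //; exact: (key y z).
Qed.

End ConvexPartition.

Theorem theorem6p14 (S : set No) (Pi : set (set No))
  (hS : surreal_substructure S) (hPi : convex_partition S Pi)
  (hSmp : surreal_substructure (Smp S Pi)) :
  [<-> sharp S Pi;
       closed_in S (Smp S Pi) /\ (forall x, S x -> pi_least Pi x = mu S Pi x);
       (forall x y, S x -> S y -> simpler x y ->
          simpler (pi_least Pi x) (pi_least Pi y));
       closed_in S (Smp S Pi) /\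
       (forall x y, S x -> S y -> leNo x y -> leNo (mu S Pi x) (mu S Pi y))].
Proof.
tfae.
- move=> /(sharp_pi_least_monotone hS hPi) mono.
  by split; [exact: pi_least_monotone_closed|exact: pi_least_monotone_mu].
- by move=> [cl piE]; exact: mu_pi_least_monotone.
- move=> mono; split; first exact: pi_least_monotone_closed.
  move=> x y Sx Sy xy; rewrite -!(pi_least_monotone_mu hS hPi mono)//.
  exact: (pi_least_le hS hPi).
- move=> [cl inc]; apply: pi_least_monotone_sharp => //.
  by apply: mu_pi_least_monotone => //; exact: mu_increasing_pi_least.
Qed.
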